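(* Let $n\ge1$ and let $v\in\mathbb Z_{\ge0}^n$ be a dimension vector. The nilpotent cone $\mathfrak N_{T_n,v}$ of the tadpole quiver $T_n$ is isomorphic to the fiber product $$\mathfrak H(0,V_1)\times_{\mathcal N(V_1)}\mathfrak H(V_1,V_2)\times_{\mathcal N(V_2)}\cdots\times_{\mathcal N(V_{n-1})}\mathfrak H(V_{n-1},V_n)\times_{\mathcal N(V_n)}\mathfrak X(V_n),$$ where the maps $\mathfrak H(V_{i-1},V_i)\to\mathcal N(V_i)$ (with $V_0=0$) are $(h,\overline h)\mapsto h\overline h$, the maps $\mathfrak H(V_i,V_{i+1})\to\mathcal N(V_i)$ are $(h,\overline h)\mapsto\overline h h$, and the map $\mathfrak X(V_n)\to\mathcal N(V_n)$ is $(h,\overline h)\mapsto[h,\overline h]$.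
   Context: All vector spaces are finite-dimensional over $\mathbb C$; varieties are taken with their reduced structure. The tadpole quiver $T_n$ has vertices $1,\dots,n$ and edges $h_1,\dots,h_n$, where $h_i$ goes from $i$ to $i+1$ for $1\le i\le n-1$ and $h_n$ is a loop at $n$. Let $H=\{h_1,\dots,h_n,\overline{h_1},\dots,\overline{h_n}\}$, where the bar denotes the reversed arrow. For $h\in H$, $in(h)$ and $out(h)$ denote its source and target, and $\omega(h_i)=1$, $\omega(\overline{h_i})=-1$. For a dimension vector $v$ fix vector spaces $V_i$ with $\dim V_i=v_i$ and put $M_{T_n,v}=\bigoplus_{h\in H}\mathrm{Hom}(V_{in(h)},V_{out(h)})$, with elements $B=(B_h)_{h\in H}$. The moment map has components $\mu(B)_i=\sum_{h\in H:\,in(h)=i}\omega(h)B_{\overline h}B_h\in\mathrm{End}(V_i)$. An element $B$ is nilpotent if there is $N\in\mathbb N$ such that for every $k>N$ and every path $g_1,\dots,g_k\in H$ with $out(g_j)=in(g_{j+1})$, one has $B_{g_k}\cdots B_{g_1}=0$. The nilpotent cone is $\mathfrak N_{T_n,v}=\{B\in M_{T_n,v}\mid\mu(B)=0,\ B\text{ nilpotent}\}$. For a vector space $U$, $\mathcal N(U)$ is the variety of nilpotent endomorphisms of $U$. For vector spaces $U_1,U_2$, $\mathfrak H(U_1,U_2)=\{(h,\overline h)\mid h\in\mathrm{Hom}(U_1,U_2),\ \overline h\in\mathrm{Hom}(U_2,U_1),\ \overline h h\in\mathcal N(U_1),\ h\overline h\in\mathcal N(U_2)\}$. $\mathfrak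 X(U)$ is the variety of pairs $(h,\overline h)\in\mathrm{End}(U)^2$ that are nilpotent as a set, i.e. there is $N$ such that every composition of more than $N$ operators each equal to $h$ or $\overline h$ is $0$. *)

(* Defs.v *)
From mathcomp Require Import all_boot all_order all_algebra.
From mathcomp Require Import complex.
From mathcomp Require Import mpoly.
From mathcomp Require Export reals.

Set Implicit Arguments.
Unset Strict Implicit.
Unset Printing Implicit Defensive.

Import GRing.Theory.
Local Open Scope ring_scope.

Section AffineVarieties.
Variable K : fieldType.

Structure affine_space := AffineSpace {
  aff_point :> Type;
  aff_index : finType;
  aff_coord : aff_point -> aff_index -> K;
  aff_of : (aff_index -> K) -> aff_point;
  aff_ofK : forall x i, aff_coord (aff_of x) i = x i;
  aff_coordK : forall a, aff_of (aff_coord a) = a }.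

Definition peval (A : affine_space) (p : {mpoly K[#|aff_index A|]}) (a : A) : K :=
  p.@[fun k => aff_coord a (enum_val k)].

Definition zariski_closed (A : affine_space) (X : A -> Prop) : Prop :=
  exists S : {mpoly K[#|aff_index A|]} -> Prop,
    forall a : A, X a <-> (forall p, S p -> peval p a = 0).

Definition polynomial_map (A B : affine_space) (f : A -> B) : Prop :=
  forall j : aff_index B, exists p : {mpoly K[#|aff_index A|]},
    forall a : A, aff_coord (f a) j = peval p a.

(* A reduced affine variety is a closed subset X of an affine space, and its
   morphisms to Y are the restrictions to X of the polynomial maps of the ambient
   spaces sending X into Y.  That X and Y are closed is part of the definition. *)
Definition isomorphic_varieties (A B : affine_space)
    (X : A -> Prop) (Y : B -> Prop) : Prop :=
  [/\ zariski_closed X, zariski_closed Y &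
    exists (f : A -> B) (g : B -> A),
      [/\ polynomial_map f, polynomial_map g,
          forall a, X a -> Y (f a) /\ g (f a) = a &
          forall b, Y b -> X (g b) /\ f (g b) = b]].

(* Hom(K^d, K^e), a linear map being its matrix acting on column vectors, so
   that composition is *m in the usual order. *)
Section HomSpace.
Variables d e : nat.

Lemma hom_ofK (x : 'I_e * 'I_d -> K) i :
  (\matrix_(a, b) x (a, b) : 'M_(e, d)) i.1 i.2 = x i.
Proof. by rewrite mxE; case: i. Qed.

Lemma hom_coordK (M : 'M[K]_(e, d)) : \matrix_(a, b) M (a, b).1 (a, b).2 = M.
Proof. by apply/matrixP=> a b; rewrite mxE. Qed.

Definition hom_space : affine_space :=
  @AffineSpace 'M[K]_(e, d) ('I_e * 'I_d)%type (fun M i => M i.1 i.2)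
    (fun x => \matrix_(a, b) x (a, b)) hom_ofK hom_coordK.

End HomSpace.

Section ProdSpace.
Variables A B : affine_space.

Definition prod_coord (c : A * B) (i : aff_index A + aff_index B) : K :=
  match i with inl i => aff_coord c.1 i | inr i => aff_coord c.2 i end.

Definition prod_of (x : aff_index A + aff_index B -> K) : A * B :=
  (aff_of (fun i => x (inl i)), aff_of (fun i => x (inr i))).

Lemma prod_ofK x i : prod_coord (prod_of x) i = x i.
Proof. by case: i => i /=; rewrite aff_ofK. Qed.

Lemma prod_coordK c : prod_of (prod_coord c) = c.
Proof. by case: c => a b; rewrite /prod_of /= !aff_coordK. Qed.

Definition prod_space : affine_space :=
  @AffineSpace (A * B)%type (aff_index A + aff_index B)%type
    prod_coord prod_of prod_ofK prod_coordK.

End ProdSpace.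

Section BigProdSpace.
Variables (I : finType) (A : I -> affine_space).

Definition bigprod_coord (c : {dffun forall i, A i}) (t : {i & aff_index (A i)}) : K :=
  aff_coord (c (tag t)) (tagged t).

Definition bigprod_of (x : {i & aff_index (A i)} -> K) : {dffun forall i, A i} :=
  [ffun i => aff_of (fun k => x (Tagged (fun i => aff_index (A i)) k))].

Lemma bigprod_ofK x t : bigprod_coord (bigprod_of x) t = x t.
Proof. by case: t => i k; rewrite /bigprod_coord /= ffunE aff_ofK. Qed.

Lemma bigprod_coordK c : bigprod_of (bigprod_coord c) = c.
Proof. by apply/ffunP=> i; rewrite ffunE -[RHS]aff_coordK. Qed.

Definition bigprod_space : affine_space :=
  @AffineSpace {dffun forall i, A i} {i & aff_index (A i)}
    bigprod_coord bigprod_of bigprod_ofK bigprod_coordK.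

End BigProdSpace.

End AffineVarieties.

Record quiver := Quiver {
  vertex : finType;
  edge : finType;
  source : edge -> vertex;
  target : edge -> vertex }.

Section NilpotentCone.
Variables (K : fieldType) (Q : quiver).

(* (e, false) is the edge e and (e, true) is the reversed edge. *)
Definition arrow : finType := (edge Q * bool)%type.

Definition bar (h : arrow) : arrow := (h.1, ~~ h.2).

Definition ain (h : arrow) : vertex Q := if h.2 then target h.1 else source h.1.

Definition aout (h : arrow) : vertex Q := ain (bar h).

Definition omega (h : arrow) : K := if h.2 then -1 else 1.

Lemma aout_bar h : aout (bar h) = ain h.
Proof. by case: h => e []. Qed.

Variable v : vertex Q -> nat.

(* The spaces V_i are taken to be K^(v i). *)
Definition rep_space : affine_space K :=
  bigprod_space (fun h : arrow => hom_space K (v (ain h)) (v (aout h))).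

Lemma dim_ain i (h : {h : arrow | ain h == i}) : v (ain (val h)) = v i.
Proof. by rewrite (eqP (valP h)). Qed.

Lemma dim_aout_bar i (h : {h : arrow | ain h == i}) : v (aout (bar (val h))) = v i.
Proof. by rewrite aout_bar dim_ain. Qed.

(* The cast only identifies End(V_{in(h)}) with End(V_i) when in(h) = i. *)
Definition moment_map (B : rep_space) (i : vertex Q) : 'M[K]_(v i) :=
  \sum_(h : {h : arrow | ain h == i})
     omega (val h) *: castmx (dim_aout_bar h, dim_ain h)
                        ((B (bar (val h)) : 'M[K]_(_, _)) *m B (val h)).

(* [path_cons h p] runs through h first and then through p. *)
Inductive qpath : vertex Q -> vertex Q -> Type :=
  | path_nil i : qpath i i
  | path_cons h j of qpath (aout h) j : qpath (ain h) j.

Fixpoint path_length i j (p : qpath i j) : nat :=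
  match p with path_nil _ => 0%N | path_cons _ _ q => (path_length q).+1 end.

Fixpoint path_comp (B : rep_space) i j (p : qpath i j) : 'M[K]_(v j, v i) :=
  match p with
  | path_nil _ => 1%:M
  | path_cons h _ q => path_comp B q *m B h
  end.

Definition nilpotent_rep (B : rep_space) : Prop :=
  exists N : nat, forall i j (p : qpath i j),
    (N < path_length p)%N -> path_comp B p = 0.

Definition nilpotent_cone (B : rep_space) : Prop :=
  (forall i, moment_map B i = 0) /\ nilpotent_rep B.

End NilpotentCone.

(* Vertices and edges are numbered from 0; [insubd i i.+1] is i.+1 when this is
   again a vertex, and i at the last vertex, which carries the loop. *)
Definition tadpole (n : nat) : quiver :=
  @Quiver 'I_n 'I_n (fun i => i) (fun i => insubd i i.+1).

Section FiberProduct.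
Variable K : fieldType.

Definition nilpotent_endo d (A : 'M[K]_d) : Prop := exists N : nat, A ^+ N = 0.

Definition pair_space (d1 d2 : nat) : affine_space K :=
  prod_space (hom_space K d1 d2) (hom_space K d2 d1).

Definition pair_left d1 d2 (p : pair_space d1 d2) : 'M[K]_d1 :=
  (p.2 : 'M_(d1, d2)) *m p.1.

Definition pair_right d1 d2 (p : pair_space d1 d2) : 'M[K]_d2 :=
  (p.1 : 'M_(d2, d1)) *m p.2.

Definition frakH d1 d2 (p : pair_space d1 d2) : Prop :=
  nilpotent_endo (pair_left p) /\ nilpotent_endo (pair_right p).

Definition bracket d (p : pair_space d d) : 'M[K]_d :=
  pair_right p - pair_left p.

Definition frakX d (p : pair_space d d) : Prop :=
  exists N : nat, forall s : seq bool, (N < size s)%N ->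
    \prod_(b <- s) (if b then p.1 else p.2 : 'M[K]_d) = 0.

Variables (n : nat) (v : 'I_n.+1 -> nat).

(* Dimensions of V_0 = 0, V_1, ..., V_{n+1}: this indexing of the spaces starts
   at 1 and that of v at 0. *)
Definition dimV (k : nat) : nat := if k is j.+1 then v (inord j) else 0%N.

Lemma dimV_ord (i : 'I_n.+1) : dimV i.+1 = v i.
Proof. by rewrite /= inord_val. Qed.

Definition chain_space : affine_space K :=
  prod_space (bigprod_space (fun k : 'I_n.+1 => pair_space (dimV k) (dimV k.+1)))
             (pair_space (dimV n.+1) (dimV n.+1)).

(* The factor of index k is frakH(V_k, V_{k+1}); its right neighbour is the factor
   of index k+1, or frakX(V_{n+1}) when k = n. *)
Definition fiber_product (z : chain_space) : Prop :=
  [/\ forall k : 'I_n.+1, frakH (z.1 k),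
      frakX z.2,
      forall k (ltSk : (k.+1 < n.+1)%N),
        pair_right (z.1 (Ordinal (ltnW ltSk))) = pair_left (z.1 (Ordinal ltSk)) &
      pair_right (z.1 ord_max) = bracket z.2].

End FiberProduct.

(* Main.v *)
Require Import Defs.
From mathcomp Require Import all_boot all_order all_algebra.
From mathcomp Require Import reals complex.
From mathcomp Require Import mpoly zify.

(** Write [x_i], [y_i] for the maps carried by the edge [h_i] and its reverse
    along the tail of the tadpole, and [a], [b] for the two maps carried by the
    loop.  The isomorphism only regroups the components of a representation
    into the pairs [(x_i, y_i)] and one pair of endomorphisms of the last
    space.  At an inner vertex the moment map is [y_i x_i - x_(i-1) y_(i-1)],
    which is the gluing condition of the fiber product as it stands; at the last
    vertex it is [- x y] minus the commutator of the loop with its reverse, so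
    the two loop maps are swapped to turn the sign into the bracket of the
    fiber product ([chain_of], [rep_of]).  Since this bijection is linear, what
    remains is that it matches the two nilpotency conditions
    ([nilpotent_coneP]) and that the fiber product is closed; the cone is then
    closed as a preimage.

    Nilpotency of a representation gives nilpotency of the loop pair, because
    words in [a] and [b] are paths.  Conversely, let [c_i] be the round trip at
    the vertex [i] ([turn]).  The relations say that a round trip to the right
    equals a round trip to the left, so [c] commutes with all [x_i] and [y_i],
    and that [c] at the last vertex is the commutator of [a] and [b].  Hence a
    path starting at [i] whose rightmost vertex is [m] equals
    [Z x_(m-1) ... x_i], where all back-and-forth moves have been collected at
    [m] into powers of [c_m], or, when [m] is the last vertex, into combinations
    of words in [a] and [b] in which each [c] counts for two letters ([normal_form]).  These
    collected factors get long with the path.  Long words in [a] and [b] vanish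
    by hypothesis, and [c_i ^ (i+1) = 0] since [c] vanishes at the first vertex
    and [c_(i+1) ^ (k+1) = x_i c_i ^ k y_i].  So long paths vanish; the
    same identity shows that all pairs [(x_i, y_i)] are nilpotent.

    Closedness of the fiber product needs nilpotency to be a polynomial
    condition, that is, a bound on its exponent: if all long words in some
    endomorphisms of a [d]-dimensional space vanish, then those of length [d]
    already do ([nilpotent_words_bound]).

    Composable maps between spaces of different dimensions are compared after
    padding them by zeros to square matrices of one common size ([resize]), so
    that all computations take place in a single ring. *)

Set Implicit Arguments.
Unset Strict Implicit.
Unset Printing Implicit Defensive.

Import GRing.Theory.

Local Open Scope ring_scope.
Local Open Scope complex_scope.

(** * Polynomial functions and closed sets *)

Section PolynomialFunctions.
Variables (K : fieldType) (A : affine_space K).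

Definition polyfun (phi : A -> K) : Prop :=
  exists p : {mpoly K[#|aff_index A|]}, forall a, phi a = peval p a.

Lemma polyfun_cst c : polyfun (fun=> c).
Proof. by exists c%:MP => a; rewrite /peval mevalC. Qed.

Lemma polyfun_coord k : polyfun (fun a => aff_coord a k).
Proof.
by exists 'X_(enum_rank k) => a; rewrite /peval mevalXU enum_rankK.
Qed.

Lemma polyfunD phi psi :
  polyfun phi -> polyfun psi -> polyfun (fun a => phi a + psi a).
Proof. by move=> [p Hp] [q Hq]; exists (p + q) => a; rewrite /peval mevalD Hp Hq. Qed.

Lemma polyfunM phi psi :
  polyfun phi -> polyfun psi -> polyfun (fun a => phi a * psi a).
Proof. by move=> [p Hp] [q Hq]; exists (p * q) => a; rewrite /peval mevalM Hp Hq. Qed.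

Lemma polyfun_sum (I : Type) (r : seq I) (phi : I -> A -> K) :
  (forall i, polyfun (phi i)) -> polyfun (fun a => \sum_(i <- r) phi i a).
Proof.
move=> Hphi; elim: r => [|i r [p Hp]].
  by exists 0 => a; rewrite big_nil /peval meval0.
have [q Hq] := Hphi i.
by exists (q + p) => a; rewrite big_cons Hp Hq /peval mevalD.
Qed.

Definition polymx m n (M : A -> 'M[K]_(m, n)) : Prop :=
  forall i j, polyfun (fun a => M a i j).

Lemma eq_polymx m n (M M' : A -> 'M[K]_(m, n)) : M =1 M' -> polymx M -> polymx M'.
Proof. by move=> eqM HM i j; have [p Hp] := HM i j; exists p => a; rewrite -eqM. Qed.

Lemma polymx_cst m n (M : 'M[K]_(m, n)) : polymx (fun=> M).
Proof. by move=> i j; apply: polyfun_cst. Qed.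

Lemma polymxM m n p (M : A -> 'M[K]_(m, n)) (M' : A -> 'M[K]_(n, p)) :
  polymx M -> polymx M' -> polymx (fun a => M a *m M' a).
Proof.
move=> HM HM' i j.
have [p0 Hp] : polyfun (fun a => \sum_k M a i k * M' a k j).
  by apply: polyfun_sum => k; apply: polyfunM.
by exists p0 => a; rewrite mxE.
Qed.

Lemma polymxB m n (M M' : A -> 'M[K]_(m, n)) :
  polymx M -> polymx M' -> polymx (fun a => M a - M' a).
Proof.
move=> HM HM' i j.
have [p Hp] : polyfun (fun a => M a i j + -1 * M' a i j).
  by apply: polyfunD => //; apply: polyfunM => //; apply: polyfun_cst.
by exists p => a; rewrite !mxE -mulN1r.
Qed.

Lemma polymx_prod (I : Type) (r : seq I) n (M : I -> A -> 'M[K]_n) :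
  (forall i, polymx (M i)) -> polymx (fun a => \prod_(i <- r) M i a).
Proof.
move=> HM; elim: r => [|i r IH].
  by apply: eq_polymx (polymx_cst 1) => a; rewrite big_nil.
by apply: eq_polymx (polymxM (HM i) IH) => a; rewrite big_cons.
Qed.

Lemma polymxX n N (M : A -> 'M[K]_n) : polymx M -> polymx (fun a => M a ^+ N).
Proof.
move=> HM; elim: N => [|N IH]; first exact: polymx_cst.
by apply: eq_polymx (polymxM HM IH) => a; rewrite exprS.
Qed.

End PolynomialFunctions.

Section ClosedSets.
Variables (K : fieldType) (A : affine_space K).

(** Every closed set is cut out by all the polynomials that vanish on it.  This
    canonical choice of equations spares choosing one family of equations for
    each member of a family of closed sets. *)
Lemma zariski_closedP (X : A -> Prop) :
  zariski_closed X <->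
  forall a, (forall p, (forall b, X b -> peval p b = 0) -> peval p a = 0) -> X a.
Proof.
split=> [[S HS] a Ha | HX].
  by apply/HS=> p Sp; apply: Ha => b /HS; apply.
exists (fun p => forall b, X b -> peval p b = 0) => a; split; last exact: HX.
by move=> Xa p; apply.
Qed.

Lemma eq_zariski_closed (X Y : A -> Prop) :
  (forall a, X a <-> Y a) -> zariski_closed X -> zariski_closed Y.
Proof. by move=> eqXY [S HS]; exists S => a; rewrite -eqXY. Qed.

Lemma zariski_closed_forall (T : Type) (X : T -> A -> Prop) :
  (forall t, zariski_closed (X t)) -> zariski_closed (fun a => forall t, X t a).
Proof.
move=> HX; apply/zariski_closedP => a Ha t.
have/zariski_closedP := HX t; apply=> p Hp.
by apply: Ha => b Xb; apply: Hp.
Qed.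

Lemma zariski_closed_and (X Y : A -> Prop) :
  zariski_closed X -> zariski_closed Y -> zariski_closed (fun a => X a /\ Y a).
Proof.
move=> HX HY.
apply: eq_zariski_closed
  (zariski_closed_forall (X := fun b : bool => if b then X else Y) _).
  by move=> a; split=> [H | [Xa Ya] []] //; split; [apply: (H true) | apply: (H false)].
by case.
Qed.

Lemma zariski_closed_mx0 m n (M : A -> 'M[K]_(m, n)) :
  polymx M -> zariski_closed (fun a => M a = 0).
Proof.
move=> HM; exists (fun p => exists i j, forall a, M a i j = peval p a) => a; split.
  by move=> Ma0 p [i [j Hp]]; rewrite -Hp Ma0 mxE.
move=> Ha; apply/matrixP=> i j; rewrite mxE.
by have [p Hp] := HM i j; rewrite Hp; apply: Ha; exists i, j.
Qed.

Lemma zariski_closed_mxeq m n (M N : A -> 'M[K]_(m, n)) :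
  polymx M -> polymx N -> zariski_closed (fun a => M a = N a).
Proof.
move=> HM HN; apply: eq_zariski_closed (zariski_closed_mx0 (polymxB HM HN)) => a.
by split=> /eqP; rewrite ?subr_eq0 => /eqP // ->; rewrite subrr.
Qed.

End ClosedSets.

(** A polynomial map has finitely many coordinates, so polynomials representing
    them can be chosen and substituted simultaneously. *)
Lemma polyfun_comp (K : fieldType) (A B : affine_space K) (f : A -> B) (phi : B -> K) :
  polynomial_map f -> polyfun phi -> polyfun (fun a => phi (f a)).
Proof.
move=> /fin_all_exists[q Hq] [p Hp].
exists (p \mPo [tuple q (enum_val k) | k < #|aff_index B|]) => a.
rewrite Hp /peval comp_mpoly_meval; apply: meval_eq => k.
by rewrite tnth_mktuple -/(peval _ _) Hq.
Qed.

Lemma zariski_closed_preimage (K : fieldType) (A B : affine_space K) (f : A -> B)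
    (Y : B -> Prop) :
  polynomial_map f -> zariski_closed Y -> zariski_closed (fun a => Y (f a)).
Proof.
move=> Hf [S HS].
exists (fun q => exists2 p, S p & forall a, peval p (f a) = peval q a) => a.
rewrite HS; split=> [Ha q [p Sp <-] | Ha p Sp]; first exact: Ha.
have [q Hq] : polyfun (fun a => peval p (f a)) by apply: polyfun_comp => //; exists p.
by rewrite Hq; apply: Ha; exists p.
Qed.

(** For mutually inverse polynomial maps of the ambient spaces it is enough that
    one side be closed: the other is its preimage. *)
Lemma isomorphic_varieties_of_bijection (K : fieldType) (A B : affine_space K)
    (X : A -> Prop) (Y : B -> Prop) (f : A -> B) (g : B -> A) :
  polynomial_map f -> polynomial_map g -> cancel f g -> cancel g f ->
  (forall a, X a <-> Y (f a)) -> zariski_closed Y -> isomorphic_varieties X Y.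
Proof.
move=> Hf Hg fK gK XY HY; split=> //.
  by apply: eq_zariski_closed (zariski_closed_preimage Hf HY) => a; rewrite XY.
exists f, g; split=> // [a /XY | b Yb]; first by split; last exact: fK.
by split; [apply/XY; rewrite gK | exact: gK].
Qed.

(** * A bound on the length of nonzero words *)

Section NilpotentWords.
Variables (K : fieldType) (T : finType) (d : nat) (a : T -> 'M[K]_d).

(** Its row space is spanned by the rows of all words of length [k]. *)
Fixpoint word_span (k : nat) : 'M[K]_d :=
  if k is k'.+1 then (\sum_t (word_span k' *m a t))%MS else 1%:M.

Lemma word_sub_span (s : seq T) : (\prod_(t <- s) a t <= word_span (size s))%MS.
Proof.
elim/last_ind: s => [|s t IH]; first by rewrite submx1.
rewrite size_rcons -cats1 big_cat big_seq1 /=.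
by apply: (sumsmx_sup t) => //; apply: submxMr.
Qed.

Lemma word_span_mul0 k m (M : 'M[K]_(d, m)) :
  (forall s, size s = k -> \prod_(t <- s) a t *m M = 0) -> word_span k *m M = 0.
Proof.
elim: k m M => [|k IH] m M HM /=.
  by have := HM [::] erefl; rewrite big_nil.
apply/eqP; rewrite -submx0 sumsmxMr_gen; apply/sumsmx_subP=> t _.
rewrite genmxE -mulmxA IH ?submx0 // => s sk.
rewrite mulmxA -[X in X *m M]/(_ * _) -(big_seq1 *%R t a) -big_cat HM //.
by rewrite size_cat sk addn1.
Qed.

Lemma word_span_decr k : (word_span k.+1 <= word_span k)%MS.
Proof.
elim: k => [|k IH]; first exact: submx1.
apply/sumsmx_subP=> t _; apply: (submx_trans (submxMr _ IH)).
exact: (sumsmx_sup t).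
Qed.

(** The recursion for the spans is monotone, so one equality between consecutive
    spans propagates to all later ones. *)
Lemma word_span_stable k : (word_span k <= word_span k.+1)%MS ->
  forall j, (word_span k <= word_span (j + k))%MS.
Proof.
move=> Hk; elim=> [|j IH]; first exact: submx_refl.
apply: submx_trans Hk _ => /=; apply/sumsmx_subP=> t _.
by apply: (sumsmx_sup t) => //; apply: submxMr.
Qed.

(** The spans of the words of length [k] decrease with [k] and are eventually
    zero, so they cannot stabilize before reaching zero: the dimension drops at
    each step. *)
Lemma nilpotent_words_bound N :
  (forall s : seq T, (N < size s)%N -> \prod_(t <- s) a t = 0) ->
  forall s : seq T, (d <= size s)%N -> \prod_(t <- s) a t = 0.
Proof.
move=> HN.
have U0 k : (N < k)%N -> word_span k = 0.
  move=> Nk; rewrite -[LHS]mulmx1; apply: word_span_mul0 => s sk.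
  by rewrite mulmx1 HN ?sk.
have rankU k : word_span k = 0 \/ (\rank (word_span k) + k <= d)%N.
  elim: k => [|k [IH|IH]]; first by right; rewrite addn0 rank_leq_col.
    by left; apply/eqP; rewrite -submx0 -IH word_span_decr.
  have [le_rk eq_rk] := mxrank_leqif_sup (word_span_decr k).
  case stab: (word_span k <= word_span k.+1)%MS.
    left; apply/eqP; rewrite -submx0 -(U0 (N.+1 + k)%N); last by rewrite leq_addr.
    by apply: submx_trans (word_span_decr k) (word_span_stable stab N.+1).
  right; rewrite addnS -addSn; apply: leq_trans IH.
  by rewrite leq_add2r ltn_neqAle eq_rk stab le_rk.
move=> s ds; have := word_sub_span s; suff -> : word_span (size s) = 0.
  by rewrite submx0 => /eqP.
case: (rankU (size s)) => // rk; apply/eqP; rewrite -mxrank_eq0.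
by move: (leq_trans rk ds); rewrite -{3}[size s]add0n leq_add2r leqn0.
Qed.

End NilpotentWords.

(** * The fiber product is closed *)

Lemma nilpotent_endoE (K : fieldType) d (A : 'M[K]_d) : nilpotent_endo A <-> A ^+ d = 0.
Proof.
split=> [[N AN]|Ad]; last by exists d.
have HN (s : seq unit) : (N < size s)%N -> \prod_(t <- s) A = 0.
  move=> /ltnW Ns; rewrite big_const_seq count_predT iter_mulr_1.
  by rewrite -(subnK Ns) exprD AN mulr0.
have := @nilpotent_words_bound _ unit _ (fun=> A) N HN (nseq d tt).
by rewrite size_nseq big_const_seq count_predT iter_mulr_1 size_nseq; apply.
Qed.

Lemma frakXE (K : fieldType) d (p : pair_space K d d) :
  frakX p <->
  forall s : seq bool, (d <= size s)%N ->
    \prod_(b <- s) (if b then p.1 else p.2 : 'M[K]_d) = 0.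
Proof.
split=> [[N HN] | Hd]; last by exists d => s /ltnW/Hd.
exact: nilpotent_words_bound HN.
Qed.

Section FiberProductClosed.
Variables (K : fieldType) (n : nat) (v : 'I_n.+1 -> nat).

Let chain := chain_space K v.

Lemma polymx_chain1 (k : 'I_n.+1) : polymx (fun z : chain => (z.1 k).1 : 'M_(_, _)).
Proof.
move=> i j.
pose t : aff_index chain := inl (Tagged
  (fun k : 'I_n.+1 => aff_index (pair_space K (dimV v k) (dimV v k.+1))) (inl (i, j))).
by have [p Hp] := polyfun_coord t; exists p => z; rewrite -Hp.
Qed.

Lemma polymx_chain2 (k : 'I_n.+1) : polymx (fun z : chain => (z.1 k).2 : 'M_(_, _)).
Proof.
move=> i j.
pose t : aff_index chain := inl (Tagged
  (fun k : 'I_n.+1 => aff_index (pair_space K (dimV v k) (dimV v k.+1))) (inr (i, j))).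
by have [p Hp] := polyfun_coord t; exists p => z; rewrite -Hp.
Qed.

Arguments polymx_chain1 k : clear implicits.
Arguments polymx_chain2 k : clear implicits.

Lemma polymx_end1 : polymx (fun z : chain => z.2.1 : 'M_(_, _)).
Proof. by move=> i j; exact: (polyfun_coord (inr (inl (i, j)) : aff_index chain)). Qed.

Lemma polymx_end2 : polymx (fun z : chain => z.2.2 : 'M_(_, _)).
Proof. by move=> i j; exact: (polyfun_coord (inr (inr (i, j)) : aff_index chain)). Qed.

Lemma polymx_left k : polymx (fun z : chain => pair_left (z.1 k)).
Proof. exact: polymxM (polymx_chain2 k) (polymx_chain1 k). Qed.

Lemma polymx_right k : polymx (fun z : chain => pair_right (z.1 k)).
Proof. exact: polymxM (polymx_chain1 k) (polymx_chain2 k). Qed.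

Arguments polymx_left k : clear implicits.
Arguments polymx_right k : clear implicits.

Lemma polymx_bracket : polymx (fun z : chain => bracket z.2).
Proof.
apply: eq_polymx (polymxB (polymxM polymx_end1 polymx_end2)
  (polymxM polymx_end2 polymx_end1)) => z //.
Qed.

Lemma fiber_product_closed : zariski_closed (fiber_product (K := K) (v := v)).
Proof.
pose X (z : chain) := (forall k : 'I_n.+1,
    pair_left (z.1 k) ^+ dimV v k = 0 /\ pair_right (z.1 k) ^+ dimV v k.+1 = 0) /\
  ((forall s : seq bool, (dimV v n.+1 <= size s)%N ->
    \prod_(b <- s) (if b then z.2.1 else z.2.2 : 'M[K]_(dimV v n.+1)) = 0) /\
  ((forall k (ltSk : (k.+1 < n.+1)%N),
     pair_right (z.1 (Ordinal (ltnW ltSk))) = pair_left (z.1 (Ordinal ltSk))) /\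
   pair_right (z.1 ord_max) = bracket z.2)).
apply: (@eq_zariski_closed _ _ X) => [z|].
  split=> [[Hk [Hs [Hr He]]] | [Hk Hs Hr He]].
    split=> //; last exact/frakXE.
    by move=> k; split; apply/nilpotent_endoE; have [] := Hk k.
  split; last by split=> //; apply/frakXE.
  by move=> k; have [/nilpotent_endoE ? /nilpotent_endoE ?] := Hk k.
apply: zariski_closed_and.
  apply: zariski_closed_forall => k; apply: zariski_closed_and.
    exact: zariski_closed_mx0 (polymxX _ (polymx_left k)).
  exact: zariski_closed_mx0 (polymxX _ (polymx_right k)).
apply: zariski_closed_and.
  apply: zariski_closed_forall => s; apply: zariski_closed_forall => _.
  apply: zariski_closed_mx0.
  by apply: polymx_prod => -[]; [apply: polymx_end1 | apply: polymx_end2].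
apply: zariski_closed_and.
  apply: zariski_closed_forall => k; apply: zariski_closed_forall => ltSk.
  apply: zariski_closed_mxeq; first exact: (polymx_right (Ordinal _)).
  exact: (polymx_left (Ordinal ltSk)).
by apply: zariski_closed_mxeq; [apply: polymx_right | apply: polymx_bracket].
Qed.

End FiberProductClosed.

(** * Paths on the tadpole, computed in a ring *)

Section ChainWords.
Variables (A : pzRingType) (n : nat) (x y : nat -> A) (a : bool -> A).

(** The round trip at the vertex [i] through the vertex [i - 1]; the first vertex
    has no left neighbour. *)
Definition turn (i : nat) : A := if i is j.+1 then x j * y j else 0.

Hypothesis turnE : forall i, (i < n)%N -> y i * x i = turn i.
Hypothesis turn_n : turn n = a true * a false - a false * a true.

(** By induction, since [turn i.+1 ^+ k.+1 = x i * turn i ^+ k * y i]. *)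
Lemma turn_nilpotent i : (i <= n)%N -> turn i ^+ i.+1 = 0.
Proof.
elim: i => [|i IH] lt_in; first by rewrite expr1.
have -> m : turn i.+1 ^+ m.+1 = x i * turn i ^+ m * y i.
  elim: m => [|m IHm]; first by rewrite expr1 expr0 mulr1.
  by rewrite exprS IHm [turn i ^+ m.+1]exprS -(turnE lt_in) !mulrA.
by rewrite IH ?mulr0 ?mul0r // ltnW.
Qed.

Lemma turn_x i : (i < n)%N -> x i * turn i = turn i.+1 * x i.
Proof. by move=> lt_in; rewrite -(turnE lt_in) mulrA. Qed.

Lemma turnX_y i k : (i < n)%N -> turn i ^+ k * y i = y i * turn i.+1 ^+ k.
Proof.
move=> lt_in; elim: k => [|k IH]; first by rewrite mul1r mulr1.
by rewrite exprS -mulrA IH [in RHS]exprS -(turnE lt_in) !mulrA.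
Qed.

(** The straight path [x (i + r - 1) * ... * x i] from [i] to [i + r]. *)
Fixpoint climb (i r : nat) : A := if r is r'.+1 then climb i.+1 r' * x i else 1.

Lemma climb_turn i r : (i + r <= n)%N -> climb i r * turn i = turn (i + r) * climb i r.
Proof.
elim: r i => [|r IH] i le_n; first by rewrite addn0 mul1r mulr1.
rewrite /= -mulrA turn_x; last by lia.
by rewrite mulrA IH ?addSnnS // -mulrA.
Qed.

Lemma turn_word (s : seq bool) :
  turn n * \prod_(b <- s) a b
    = \prod_(b <- [:: true, false & s]) a b - \prod_(b <- [:: false, true & s]) a b.
Proof. by rewrite turn_n mulrBl !big_cons !mulrA. Qed.

Variable N : nat.
Hypothesis words0 : forall s : seq bool, (N < size s)%N -> \prod_(b <- s) a b = 0.

(** [Z] starts at the vertex [m] with a closed path worth [l] letters: a power of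
    the round trip, or, at the last vertex, an operator that vanishes on every
    word in the loops that completes [l] to more than [N] letters.  The second
    form is closed under differences, as needed to replace a round trip at [n]
    by a commutator. *)
Definition deep m l (Z : A) : Prop :=
  (exists P k, Z = P * turn m ^+ k /\ (l <= k.*2)%N) \/
  m = n /\ forall s : seq bool, (N < size s + l)%N -> Z * \prod_(b <- s) a b = 0.

(** A round trip at the last vertex is a difference of two words of two letters,
    so both forms of [deep n] imply the second one. *)
Lemma deep_words l Z (s : seq bool) :
  deep n l Z -> (N < size s + l)%N -> Z * \prod_(b <- s) a b = 0.
Proof.
case=> [[P [k [-> lk]]] | [_ HZ]]; last exact: HZ.
move=> Nsl; rewrite -mulrA [X in P * X](_ : _ = 0) ?mulr0 //.
have {Nsl lk} : (N < size s + k.*2)%N by lia.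
elim: k s => [|k IH] s Nsk; first by rewrite mul1r words0 //; lia.
rewrite exprSr -mulrA turn_word mulrBr.
by rewrite !IH ?subrr //=; lia.
Qed.

Lemma deep_turn m l Z : deep m l Z -> deep m l.+2 (Z * turn m).
Proof.
case=> [[P [k [-> lk]]] | [-> HZ]].
  by left; exists P, k.+1; rewrite exprSr mulrA; split=> //; lia.
right; split=> // s Ns.
rewrite -mulrA turn_word mulrBr.
by rewrite !HZ ?subrr //=; lia.
Qed.

Lemma deep_loop l Z b : deep n l Z -> deep n l.+1 (Z * a b).
Proof.
move=> HZ; right; split=> // s Ns.
have := deep_words (s := b :: s) HZ; rewrite big_cons mulrA; apply => /=; lia.
Qed.

(** When a path starts further to the right than it ever went before, the power
    of the round trip collected so far is moved across the new step. *)
Lemma deep_y m l Z : (m < n)%N -> deep m l Z -> deep m.+1 l (Z * y m).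
Proof.
move=> lt_mn [[P [k [-> lk]]] | [eq_mn _]]; last by rewrite eq_mn ltnn in lt_mn.
by left; exists (P * y m), k; rewrite -mulrA turnX_y // mulrA.
Qed.

Lemma deep_eq0 m l Z : (m <= n)%N -> deep m l Z -> (N < l)%N -> (n.*2 < l)%N -> Z = 0.
Proof.
move=> le_mn [[P [k [-> lk]]] | [_ HZ]] Nl nl.
  have -> : k = (m.+1 + (k - m.+1))%N by lia.
  by rewrite exprD turn_nilpotent // mul0r mulr0.
by have := HZ [::] Nl; rewrite big_nil mulr1.
Qed.

(** For [M] a path of length [L] starting at [i], with [i + r] the rightmost
    vertex that it visits.  Of its steps, [l] are collected in the
    closed part of [Z]; at most [r] more are spent on climbing to [i + r] and at
    most [i + r] on descending to its endpoint. *)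
Definition normal_form i L (M : A) : Prop :=
  exists r l Z, [/\ (i + r <= n)%N, deep (i + r) l Z, (L <= l + r + (i + r))%N &
                    M = Z * climb i r].

Lemma normal_form0 i M : (i <= n)%N -> normal_form i 0 M.
Proof.
move=> le_in; exists 0, 0, M; rewrite addn0 mulr1; split=> //.
by left; exists M, 0; rewrite mulr1.
Qed.

Lemma normal_form_x i L M : normal_form i.+1 L M -> normal_form i L.+1 (M * x i).
Proof.
move=> [r [l [Z [le_n HZ leL ->]]]]; exists r.+1, l, Z.
by rewrite -addSnnS /= mulrA; split=> //; lia.
Qed.

(** A step to the left followed by a climb contains a round trip, which commutes
    up to the rightmost vertex; if there is no climb, the step itself starts at
    a new rightmost vertex. *)
Lemma normal_form_y i L M :
  (i < n)%N -> normal_form i L M -> normal_form i.+1 L.+1 (M * y i).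
Proof.
move=> lt_in [[|r] [l [Z [le_n HZ leL ->]]]].
  exists 0, l, (Z * y i); rewrite addn0 /= !mulr1; split=> //; last by lia.
  by apply: deep_y => //; rewrite addn0 in HZ.
exists r, l.+2, (Z * turn (i.+1 + r)); split; [lia | | lia |].
  by apply: deep_turn; rewrite addSnnS.
rewrite -!(mulrA Z) -climb_turn; last by lia.
by rewrite [climb i r.+1]/= -mulrA.
Qed.

Lemma normal_form_loop L M b : normal_form n L M -> normal_form n L.+1 (M * a b).
Proof.
move=> [r [l [Z [le_n HZ leL ->]]]]; have r0 : r = 0 by lia.
rewrite r0 addn0 in HZ leL *; exists 0, l.+1, (Z * a b).
rewrite addn0 /= !mulr1; split=> //.
exact: deep_loop.
Qed.

(** The climb and the descent take at most [n.*2] steps together, so a length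
    beyond the bound leaves more than [N] and more than [n.*2] letters for the
    closed part. *)
Lemma normal_form_eq0 i L M : normal_form i L M -> (N + n.*2 + n.*2 < L)%N -> M = 0.
Proof.
move=> [r [l [Z [le_n HZ leL ->]]]] ltL.
by rewrite (deep_eq0 le_n HZ) ?mul0r //; lia.
Qed.

End ChainWords.

(** * Matrices of varying sizes in a common ring *)

Section Resize.
Variable K : fieldType.

(** Truncates the rows and columns, or pads them by zeros, as the sizes require. *)
Definition resize {m n m' n'} (M : 'M[K]_(m, n)) : 'M[K]_(m', n') :=
  (pid_mx m : 'M_(m', m)) *m M *m (pid_mx n : 'M_(n, n')).

Lemma resize_id m n (M : 'M[K]_(m, n)) : resize M = M.
Proof. by rewrite /resize !pid_mx_1 mul1mx mulmx1. Qed.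

Lemma resize_resize m n m' n' m'' n'' (M : 'M[K]_(m, n)) :
  (m <= m')%N -> (n <= n')%N ->
  resize (resize M : 'M_(m', n')) = resize M :> 'M_(m'', n'').
Proof.
move=> le_m le_n; rewrite /resize !mulmxA mul_pid_mx -!mulmxA mul_pid_mx.
by rewrite !(minn_idPr le_m) ?(minn_idPl le_n) !(minn_idPr le_n).
Qed.

Lemma resizeK m n m' n' (M : 'M[K]_(m, n)) :
  (m <= m')%N -> (n <= n')%N -> resize (resize M : 'M_(m', n')) = M.
Proof. by move=> le_m le_n; rewrite resize_resize // resize_id. Qed.

Lemma resizeM m n p m' n' p' (M : 'M[K]_(m, n)) (N : 'M[K]_(n, p)) :
  (n <= n')%N ->
  resize (M *m N) = (resize M : 'M_(m', n')) *m (resize N : 'M_(n', p')).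
Proof.
move=> le_n; rewrite /resize -!mulmxA (mulmxA (pid_mx n)) mul_pid_mx.
by rewrite (_ : minn _ _ = n) ?pid_mx_1 ?mul1mx //; lia.
Qed.

Lemma resizeB m n m' n' (M N : 'M[K]_(m, n)) :
  resize (M - N) = resize M - resize N :> 'M_(m', n').
Proof. by rewrite /resize mulmxBr mulmxBl. Qed.

Lemma resizeZ m n m' n' c (M : 'M[K]_(m, n)) :
  resize (c *: M) = c *: resize M :> 'M_(m', n').
Proof. by rewrite /resize -scalemxAr -scalemxAl. Qed.

Lemma resize0 m n m' n' : resize (0 : 'M[K]_(m, n)) = 0 :> 'M_(m', n').
Proof. by rewrite /resize mulmx0 mul0mx. Qed.

Lemma resize_sum m n m' n' (I : Type) (r : seq I) (M : I -> 'M[K]_(m, n)) :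
  resize (\sum_(i <- r) M i) = \sum_(i <- r) resize (M i) :> 'M_(m', n').
Proof. by rewrite /resize mulmx_sumr mulmx_suml. Qed.

Lemma resize_castmx m n p q m' n' (e : (m = p) * (n = q)) (M : 'M[K]_(m, n)) :
  resize (castmx e M) = resize M :> 'M_(m', n').
Proof. by case: e => e1 e2; case: q / e2; case: p / e1. Qed.

Lemma resize_eq0 m n m' n' (M : 'M[K]_(m, n)) :
  (m <= m')%N -> (n <= n')%N -> resize M = 0 :> 'M_(m', n') <-> M = 0.
Proof.
move=> le_m le_n; split=> [M0|->]; last exact: resize0.
by rewrite -(resizeK M le_m le_n) M0 resize0.
Qed.

Lemma resize_eq m n m' n' (M N : 'M[K]_(m, n)) :
  (m <= m')%N -> (n <= n')%N -> resize M = resize N :> 'M_(m', n') <-> M = N.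
Proof.
move=> le_m le_n; split=> [eqMN|-> //].
by rewrite -(resizeK M le_m le_n) eqMN resizeK.
Qed.

(** Padding is not unital: it sends the identity to an idempotent, which is the
    extra factor here and the reason why [resize_prod] excludes the empty
    word. *)
Lemma resizeX d d' (M : 'M[K]_d) k : (d <= d')%N ->
  resize (M ^+ k) = resize (1 : 'M_d) *m resize M ^+ k :> 'M_d'.
Proof.
move=> le_d; elim: k => [|k IH]; first by rewrite !expr0 mulmx1.
by rewrite !exprSr -[M ^+ k * M]/(M ^+ k *m M) (resizeM _ _ _ _ le_d) IH -mulmxA.
Qed.

Lemma resize_prod d d' (I : Type) (s : seq I) (M : I -> 'M[K]_d) :
  (d <= d')%N -> (0 < size s)%N ->
  resize (\prod_(i <- s) M i) = \prod_(i <- s) resize (M i) :> 'M_d'.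
Proof.
move=> le_d; elim: s => [//|i [|j s] IH] _; first by rewrite !big_seq1.
rewrite big_cons [in RHS]big_cons -IH //.
by rewrite -[M i * _]/(M i *m _) (resizeM _ _ _ _ le_d).
Qed.

Lemma polymx_resize (A : affine_space K) m n m' n' (M : A -> 'M[K]_(m, n)) :
  polymx M -> polymx (fun a => resize (M a) : 'M_(m', n')).
Proof.
move=> HM.
exact: polymxM (polymxM (@polymx_cst _ _ _ _ _) HM) (@polymx_cst _ _ _ _ _).
Qed.

Lemma mx_nocol m n (M N : 'M[K]_(m, n)) : n = 0 -> M = N.
Proof. by move=> n0; subst n; rewrite (thinmx0 M) (thinmx0 N). Qed.

Lemma mx_norow m n (M N : 'M[K]_(m, n)) : m = 0 -> M = N.
Proof. by move=> m0; subst m; rewrite (flatmx0 M) (flatmx0 N). Qed.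

End Resize.

(** * The linear isomorphism *)

Section Tadpole.
Variables (K : fieldType) (n : nat) (v : 'I_n.+1 -> nat).

Let Q := tadpole n.+1.
Let rep := @rep_space K Q v.
Let chain := chain_space K v.

Lemma val_target (e : 'I_n.+1) : @target Q e = (if e == n :> nat then n else e.+1) :> nat.
Proof.
by rewrite /= val_insubd /=; have := ltn_ord e; case: ifP; case: eqP; lia.
Qed.

Lemma target_loop : @target Q ord_max = ord_max.
Proof. by apply: ord_inj; rewrite val_target /= eqxx. Qed.

Lemma ain_loop b : @ain Q (ord_max, b) = ord_max.
Proof. by case: b => //; apply: target_loop. Qed.

Lemma target_leg i : (i < n)%N -> @target Q (inord i) = inord i.+1.
Proof.
by move=> lt_in; apply: ord_inj; rewrite val_target !inordK ?ltn_eqF //; lia.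
Qed.

(** Here [resize] only identifies equal dimensions that are not convertible,
    except for [k = 0], where both maps have an empty side.  The maps of the
    loop are swapped for the sake of the sign at the last vertex. *)
Definition chain_of (B : rep) : chain :=
  ([ffun k : 'I_n.+1 =>
      (resize (B (inord k.-1, false) : 'M_(_, _)),
       resize (B (inord k.-1, true) : 'M_(_, _)))],
   (resize (B (ord_max, true) : 'M_(_, _)), resize (B (ord_max, false) : 'M_(_, _)))).

Definition rep_of (z : chain) : rep :=
  [ffun h : arrow Q =>
     if h.1 == ord_max :> 'I_n.+1 then
       if h.2 then resize (z.2.1 : 'M_(_, _)) else resize (z.2.2 : 'M_(_, _))
     else if h.2 then resize ((z.1 (inord h.1.+1)).2 : 'M_(_, _))
     else resize ((z.1 (inord h.1.+1)).1 : 'M_(_, _))].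

Lemma dimV_loop b : v (@ain Q (ord_max, b)) = dimV v n.+1.
Proof. by rewrite ain_loop -dimV_ord. Qed.

Lemma dimV_leg (k : 'I_n.+1) b : (0 < k)%N ->
  v (@ain Q (inord k.-1, b)) = dimV v (if b then k.+1 else k).
Proof.
move=> k0; have lt_k := ltn_ord k.
have -> : @ain Q (inord k.-1, b) = inord (if b then (k : nat) else k.-1).
  by case: b => //; have := @target_leg k.-1; rewrite prednK //; apply; lia.
by case: b => //=; rewrite -[in RHS](prednK k0).
Qed.

Lemma chain_ofK : cancel chain_of rep_of.
Proof.
move=> B; apply/ffunP=> -[e b]; rewrite ffunE /=.
have [->|ne] := eqVneq e ord_max.
  by case: b; rewrite resizeK ?dimV_loop // -(dimV_loop false) ?dimV_loop.
have lt_en : (e < n)%N by have := ltn_ord e; move: ne; rewrite -val_eqE /=; lia.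
have eqe : inord (inord e.+1 : 'I_n.+1).-1 = e by rewrite inordK //= inord_val.
have Hd c : v (@ain Q (e, c)) =
    dimV v (if c then (inord e.+1 : 'I_n.+1).+1 else (inord e.+1 : 'I_n.+1)).
  by rewrite -dimV_leg ?eqe // inordK.
have Hf : (v (@ain Q (e, false)) <= dimV v (inord e.+1 : 'I_n.+1))%N by rewrite Hd.
have Ht : (v (@ain Q (e, true)) <= dimV v (inord e.+1 : 'I_n.+1).+1)%N by rewrite Hd.
by case: b; rewrite ffunE /= eqe resizeK.
Qed.

Lemma rep_ofK : cancel rep_of chain_of.
Proof.
move=> z; rewrite [RHS]surjective_pairing; congr (_, _).
  apply/ffunP=> k; rewrite ffunE [RHS]surjective_pairing.
  have [k0|k0] := posnP k.
    by congr (_, _); [apply: mx_nocol | apply: mx_norow]; rewrite k0.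
  have lt_k : (k.-1 < n)%N by have := ltn_ord k; lia.
  have eqk : inord (inord k.-1 : 'I_n.+1).+1 = k.
    by apply: ord_inj; rewrite !inordK ?prednK //; lia.
  have ne : (inord k.-1 == ord_max :> 'I_n.+1) = false.
    by apply/negbTE; rewrite -val_eqE /= inordK; lia.
  have Hf : (dimV v k <= v (@ain Q (inord k.-1, false)))%N by rewrite dimV_leg.
  have Ht : (dimV v k.+1 <= v (@ain Q (inord k.-1, true)))%N by rewrite dimV_leg.
  by rewrite !ffunE /= ne; congr (_, _); rewrite eqk resizeK.
rewrite /= !ffunE /= eqxx [RHS]surjective_pairing.
by congr (_, _); rewrite resizeK ?dimV_loop // -(dimV_loop false).
Qed.


Lemma polymx_rep (h : arrow Q) : polymx (fun B : rep => B h : 'M_(_, _)).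
Proof.
move=> i j.
pose t : aff_index rep :=
  Tagged (fun h : arrow Q => aff_index (hom_space K (v (ain h)) (v (aout h)))) (i, j).
by have [p Hp] := polyfun_coord t; exists p => B; rewrite -Hp.
Qed.
Arguments polymx_rep h : clear implicits.

Lemma polynomial_chain_of : polynomial_map chain_of.
Proof.
move=> [[k [[i j]|[i j]]]|[[i j]|[i j]]].
- have [p Hp] := polymx_resize (polymx_rep (inord k.-1, false)) i j.
  by exists p => B; rewrite -Hp /= /bigprod_coord /= ffunE.
- have [p Hp] := polymx_resize (polymx_rep (inord k.-1, true)) i j.
  by exists p => B; rewrite -Hp /= /bigprod_coord /= ffunE.
- have [p Hp] := polymx_resize (polymx_rep (ord_max, true)) i j.
  by exists p => B; rewrite -Hp.
- have [p Hp] := polymx_resize (polymx_rep (ord_max, false)) i j.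
  by exists p => B; rewrite -Hp.
Qed.

Lemma polynomial_rep_of : polynomial_map rep_of.
Proof.
move=> [[e b] [i j]].
have coordE (M : chain -> 'M_(_, _)) :
    (forall z, rep_of z (e, b) = M z) -> polymx M ->
    exists p, forall z, aff_coord (rep_of z)
      (Tagged (fun h : arrow Q => aff_index (hom_space K (v (ain h)) (v (aout h)))) (i, j)
        : aff_index rep) = peval p z.
  move=> HM polyM; have [p Hp] := polyM i j.
  by exists p => z; rewrite -Hp -HM.
have [eqe|ne] := eqVneq e ord_max; case: b i j coordE => i j coordE.
- by apply: coordE (polymx_resize (@polymx_end1 _ _ _)) => z; rewrite ffunE /= eqe eqxx.
- by apply: coordE (polymx_resize (@polymx_end2 _ _ _)) => z; rewrite ffunE /= eqe eqxx.
- apply: coordE (polymx_resize (@polymx_chain2 _ _ v (inord e.+1))) => z.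
  by rewrite ffunE /= (negbTE ne).
- apply: coordE (polymx_resize (@polymx_chain1 _ _ v (inord e.+1))) => z.
  by rewrite ffunE /= (negbTE ne).
Qed.
End Tadpole.

(** * Equivalence of the two sets of conditions *)

Section Equivalence.
Variables (K : fieldType) (n : nat) (v : 'I_n.+1 -> nat).

Let Q := tadpole n.+1.
Let rep := @rep_space K Q v.

Let D := \max_(i < n.+1) v i.

Let le_vD (i : 'I_n.+1) : (v i <= D)%N.
Proof. exact: leq_bigmax. Qed.

Let le_dimD k : (dimV v k <= D)%N.
Proof. by case: k => [|k]; last exact: le_vD. Qed.

Variable B : rep.

Let pad (h : arrow Q) : 'M[K]_D := resize (B h : 'M_(_, _)).
Let x (i : nat) : 'M[K]_D := pad (inord i, false).
Let y (i : nat) : 'M[K]_D := pad (inord i, true).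
Let a (b : bool) : 'M[K]_D := pad (ord_max, b).

Lemma pad_chain1 (k : 'I_n.+1) : (0 < k)%N ->
  resize (((chain_of B).1 k).1 : 'M_(_, _)) = x k.-1.
Proof.
move=> k0; have Hf := dimV_leg v false k0; have Ht := dimV_leg v true k0.
by rewrite ffunE resize_resize // -?[dimV _ _]Hf -?[dimV _ _.+1]Ht.
Qed.

Lemma pad_chain2 (k : 'I_n.+1) : (0 < k)%N ->
  resize (((chain_of B).1 k).2 : 'M_(_, _)) = y k.-1.
Proof.
move=> k0; have Hf := dimV_leg v false k0; have Ht := dimV_leg v true k0.
by rewrite ffunE resize_resize // -?[dimV _ _]Hf -?[dimV _ _.+1]Ht.
Qed.

Lemma pad_end (b : bool) :
  resize (if b then (chain_of B).2.1 else (chain_of B).2.2 : 'M_(dimV v n.+1)) = a b.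
Proof. by case: b; rewrite resize_resize // (dimV_loop v _). Qed.

Lemma pad_right (k : 'I_n.+1) :
  resize (pair_right ((chain_of B).1 k)) = turn x y k :> 'M_D.
Proof.
have [k0|k0] := posnP k.
  have -> : turn x y k = 0 by rewrite k0.
  rewrite /pair_right.
  have -> : ((chain_of B).1 k).1 = 0 :> 'M_(_, _) by apply: mx_nocol; rewrite k0.
  by rewrite mul0mx resize0.
have -> : turn x y k = x k.-1 * y k.-1 by rewrite -[in LHS](prednK k0).
by rewrite (resizeM _ _ _ _ (le_dimD _)) pad_chain1 // pad_chain2.
Qed.

Lemma pad_left (k : 'I_n.+1) : (0 < k)%N ->
  resize (pair_left ((chain_of B).1 k)) = y k.-1 * x k.-1 :> 'M_D.
Proof.
by move=> k0; rewrite (resizeM _ _ _ _ (le_dimD _)) pad_chain1 // pad_chain2.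
Qed.

Lemma pad_bracket :
  resize (bracket (chain_of B).2) = a true * a false - a false * a true :> 'M_D.
Proof.
rewrite resizeB !(resizeM _ _ _ _ (le_dimD _)).
by rewrite (pad_end true) (pad_end false).
Qed.

(** The last vertex is the target of its loop, and every vertex but the first is
    the target of the preceding edge. *)
Lemma tadpole_incoming (F : 'I_n.+1 -> 'M[K]_D) (i : 'I_n.+1) :
  \sum_(e | @target Q e == i) F e =
    (if i == n :> nat then F ord_max else 0)
    + (if i : nat is j.+1 then F (inord j) else 0).
Proof.
rewrite big_mkcond /=.
rewrite (eq_bigr (fun e : 'I_n.+1 =>
  (if (e == ord_max) && (i == n :> nat) then F e else 0) +
  (if (e.+1 == i)%N then F e else 0))); last first.
  move=> e _; rewrite -(inj_eq (@ord_inj _) e) -(inj_eq (@ord_inj _) (insubd _ _)).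
  rewrite (val_target e) /=.
  have := ltn_ord e; have := ltn_ord i.
  do 4! [case: eqP]; rewrite ?addr0 ?add0r //=; lia.
rewrite big_split /=; congr (_ + _).
  rewrite -big_mkcond; case: eqP => _; last by rewrite big1 // => e; rewrite andbF.
  by rewrite (eq_bigl (pred1 ord_max)) ?big_pred1_eq // => e; rewrite andbT.
rewrite -big_mkcond; have := ltn_ord i; case: (nat_of_ord i) => [|j] lt_j.
  by rewrite big_pred0.
rewrite (eq_bigl (pred1 (inord j))) ?big_pred1_eq // => e.
by rewrite /= eqSS -val_eqE /= inordK //; lia.
Qed.

Lemma pad_moment_map (i : 'I_n.+1) :
  resize (moment_map B i) =
    pad (i, true) * pad (i, false)
    - (if i == n :> nat then a false * a true else 0) - turn x y i :> 'M_D.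
Proof.
rewrite /moment_map resize_sum.
transitivity (\sum_(h : arrow Q | ain h == i) omega K h *: (pad (bar h) * pad h)).
  rewrite (big_sub [pred h : arrow Q | ain h == i]
    (fun h => omega K h *: (pad (bar h) * pad h))).
  apply: eq_bigr => h _; rewrite resizeZ resize_castmx.
  by rewrite (resizeM _ _ _ _ (le_vD _)).
pose F (e : 'I_n.+1) b :=
  if @ain Q (e, b) == i then @omega K Q (e, b) *: (pad (e, ~~ b) * pad (e, b)) else 0.
transitivity (\sum_e \sum_b F e b).
  by rewrite pair_bigA big_mkcond; apply: eq_bigr => -[e b].
rewrite (eq_bigr (fun e : 'I_n.+1 =>
   (if e == i then pad (e, true) * pad (e, false) else 0)
   - (if @target Q e == i then pad (e, false) * pad (e, true) else 0))); last first.
  move=> e _; rewrite big_bool /F /= addrC /omega /= scale1r scaleN1r.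
  by congr (_ + _); case: ifP => _ //; rewrite oppr0.
rewrite sumrB -!big_mkcond big_pred1_eq tadpole_incoming opprD addrA.
by congr (_ - _); case: (nat_of_ord i).
Qed.

Let leg_relations := forall i, (i < n)%N -> y i * x i = turn x y i.
Let loop_relation := turn x y n = a true * a false - a false * a true.

Lemma moment_map0P :
  (forall i, moment_map B i = 0) <-> leg_relations /\ loop_relation.
Proof.
have mom0 (i : 'I_n.+1) : moment_map B i = 0 <->
    turn x y i = pad (i, true) * pad (i, false)
      - (if i == n :> nat then a false * a true else 0).
  rewrite -(resize_eq0 _ (le_vD i) (le_vD i)) pad_moment_map.
  by split=> [/eqP|->]; rewrite ?subrr // subr_eq0 => /eqP.
split=> [mu0 | [legs loop] i].
  split=> [i lt_in | ]; last by have /mom0 := mu0 ord_max; rewrite eqxx.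
  have /mom0 := mu0 (inord i).
  by rewrite inordK ?ltn_eqF ?subr0 // ltnS ltnW.
apply/mom0; case: eqP => [eq_in | ne_in].
  by rewrite (_ : i = ord_max); [exact: loop | apply: ord_inj].
rewrite subr0 -legs; first by rewrite /x /y inord_val.
by have := ltn_ord i; lia.
Qed.

Lemma fiber_relationsP :
  ((forall k (ltSk : (k.+1 < n.+1)%N),
      pair_right ((chain_of B).1 (Ordinal (ltnW ltSk)))
        = pair_left ((chain_of B).1 (Ordinal ltSk))) /\
   pair_right ((chain_of B).1 ord_max) = bracket (chain_of B).2)
  <-> leg_relations /\ loop_relation.
Proof.
have legP k (ltSk : (k.+1 < n.+1)%N) :
    pair_right ((chain_of B).1 (Ordinal (ltnW ltSk)))
      = pair_left ((chain_of B).1 (Ordinal ltSk)) <-> y k * x k = turn x y k.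
  rewrite -(resize_eq _ _ (le_dimD k.+1) (le_dimD k.+1)) (pad_right (Ordinal _)).
  by rewrite (pad_left (k := Ordinal ltSk)) //; split=> ->.
have loopP :
    pair_right ((chain_of B).1 ord_max) = bracket (chain_of B).2 <-> loop_relation.
  rewrite -(resize_eq _ _ (le_dimD n.+1) (le_dimD n.+1)).
  by rewrite (pad_right ord_max) pad_bracket.
split=> -[legs /loopP loop]; split=> // k ltSk; last exact/legP/legs.
exact/(legP k ltSk).
Qed.

Let vanishing_words N := forall s : seq bool, (N < size s)%N -> \prod_(b <- s) a b = 0.

Lemma frakX_wordsP : frakX (chain_of B).2 <-> exists N, vanishing_words N.
Proof.
have resize_word (s : seq bool) : (0 < size s)%N ->
    resize (\prod_(b <- s)
        (if b then (chain_of B).2.1 else (chain_of B).2.2 : 'M_(dimV v n.+1)))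
      = \prod_(b <- s) a b.
  move=> s0; rewrite (resize_prod _ (le_dimD n.+1) s0).
  by apply: eq_bigr => b _; rewrite -pad_end.
split=> -[N HN]; exists N => s Ns.
  by rewrite -resize_word ?HN ?resize0 //; apply: leq_trans Ns.
apply/(resize_eq0 _ (le_dimD n.+1) (le_dimD n.+1)).
by rewrite resize_word ?HN //; apply: leq_trans Ns.
Qed.

Lemma arrow_normal_form N (h : arrow Q) L (M : 'M_D) :
  leg_relations -> loop_relation -> vanishing_words N ->
  normal_form n x y a N (@aout Q h : 'I_n.+1) L M ->
  normal_form n x y a N (@ain Q h : 'I_n.+1) L.+1 (M * pad h).
Proof.
case: h => e b legs loop words; have [->|ne] := eqVneq e ord_max.
  by rewrite /aout /bar /= !ain_loop; apply: normal_form_loop.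
have lt_en : (e < n)%N by have := ltn_ord e; move: ne; rewrite -val_eqE /=; lia.
have target_e : (@target Q e : 'I_n.+1) = e.+1 :> nat.
  by rewrite val_target ltn_eqF.
case: b; rewrite /aout /bar /ain [_.2]/= [_.1]/= target_e.
  have -> : pad (e, true) = y e by rewrite /y inord_val.
  exact: normal_form_y.
have -> : pad (e, false) = x e by rewrite /x inord_val.
exact: normal_form_x.
Qed.

Lemma path_normal_form N : leg_relations -> loop_relation -> vanishing_words N ->
  forall (i j : 'I_n.+1) (p : @qpath Q i j),
    normal_form n x y a N i (path_length p) (resize (path_comp B p) : 'M_D).
Proof.
move=> legs loop words i j; elim=> [{}i|h {}j p IH].
  by apply: normal_form0; rewrite -ltnS.
rewrite [path_comp _ _]/= (resizeM _ _ _ _ (le_vD _)) -/(pad h) [path_length _]/=.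
exact: arrow_normal_form.
Qed.

(** The word is reversed because a path composes its first arrow on the right. *)
Lemma loop_path (s : seq bool) (i : 'I_n.+1) : i = ord_max ->
  exists2 p : @qpath Q i (ord_max : 'I_n.+1), path_length p = size s &
    resize (path_comp B p) =
      resize (1%:M : 'M_(v ord_max)) * \prod_(b <- rev s) a b :> 'M_D.
Proof.
elim: s i => [|b s IH] i def_i.
  by subst i; exists (@path_nil Q ord_max); rewrite //= big_nil mulr1.
have [p size_p comp_p] := IH _ (ain_loop n (~~ b)).
have {}def_i : i = @ain Q (ord_max, b) by rewrite ain_loop.
subst i.
exists (@path_cons Q (ord_max, b) _ p); first by rewrite /= size_p.
rewrite [path_comp _ _]/= (resizeM _ _ _ _ (le_vD _)) comp_p.
by rewrite rev_cons -cats1 big_cat big_seq1 mulrA.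
Qed.

(** The padded identity of the last space, produced by the empty path, is
    absorbed by any loop letter. *)
Lemma loop_unit b : resize (1%:M : 'M_(v ord_max)) * a b = a b.
Proof.
have <- : @aout Q (ord_max, b) = ord_max by apply: ain_loop.
by rewrite /a /pad -[_ * _](resizeM _ _ _ _ (le_vD _)) mul1mx.
Qed.

Lemma nilpotent_rep_words : nilpotent_rep B -> exists N, vanishing_words N.
Proof.
move=> [N HN]; exists N => s Ns.
have [p size_p comp_p] := loop_path (rev s) erefl.
rewrite HN ?size_p ?size_rev // resize0 revK in comp_p.
case: s Ns comp_p {size_p p} => // b s _.
by rewrite big_cons mulrA loop_unit => <-.
Qed.

Lemma nilpotent_resize d (M : 'M[K]_d) N : (d <= D)%N ->
  (resize M : 'M_D) ^+ N = 0 -> nilpotent_endo M.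
Proof.
move=> le_d MN0; exists N; apply/(resize_eq0 _ le_d le_d).
by rewrite (resizeX _ _ le_d) MN0 mulmx0.
Qed.

(** By the relations both compositions are round trips. *)
Lemma frakH_chain_of (k : 'I_n.+1) : leg_relations -> frakH ((chain_of B).1 k).
Proof.
move=> legs; have lt_k := ltn_ord k; split.
  have [k0|k0] := posnP k; first by exists 0; apply: mx_nocol; rewrite k0.
  apply: (@nilpotent_resize _ _ k.-1.+1) => //.
  by rewrite pad_left // legs ?(turn_nilpotent legs) //; lia.
apply: (@nilpotent_resize _ _ k.+1) => //.
by rewrite pad_right (turn_nilpotent legs).
Qed.

Lemma nilpotent_coneP : nilpotent_cone B <-> fiber_product (chain_of B).
Proof.
split=> [[/moment_map0P rels nilB] | [_ nilX legs loop]].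
  have [legs loop] := rels; have [fib_legs fib_loop] := (fiber_relationsP).2 rels.
  split=> // [k|]; first exact: frakH_chain_of.
  exact/frakX_wordsP/nilpotent_rep_words.
have rels : leg_relations /\ loop_relation by apply/fiber_relationsP.
split; first exact/moment_map0P.
have [legs' loop'] := rels; have /frakX_wordsP[N words] := nilX.
exists (N + n.*2 + n.*2)%N => i j p ltp.
apply/(resize_eq0 _ (le_vD _) (le_vD _)).
exact: normal_form_eq0 (path_normal_form legs' loop' words p) ltp.
Qed.

End Equivalence.

(* T_(n+1), so that n ranges over all of nat. *)
Theorem proposition2 (R : realType) (n : nat) (v : 'I_n.+1 -> nat) :
  isomorphic_varieties
    (nilpotent_cone (K := R[i]) (Q := tadpole n.+1) (v := v))
    (fiber_product (K := R[i]) (v := v)).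
Proof.
apply: (isomorphic_varieties_of_bijection
  (@polynomial_chain_of _ n v) (@polynomial_rep_of _ n v)
  (@chain_ofK _ n v) (@rep_ofK _ n v)).
  exact: nilpotent_coneP.
exact: fiber_product_closed.
Qed.
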